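(* Let $h \ge 1$, $t \ge 1$ and $q \ge 1$ be integers, and let $G$ be a finite digraph that is $(h(t+1)-1)$-dispersed and has $(h,q)$-growth. Then $c(G) > \frac{1}{e\,t}\,q^{t}$, where $c(G)$ is the cop number of the digraph $G$ and $e$ is the base of the natural logarithm.
   Context: Digraphs have no loops and no parallel edges, but may contain digons, i.e. pairs of oppositely directed edges $uv, vu$. Here $vu \in E(G)$ denotes the directed edge from $v$ to $u$, and $\mathrm{dist}(v,u)$ is the length of a shortest directed path from $v$ to $u$ ($\infty$ if there is none). Cops and robbers on a digraph $G$: the first player places each cop on a vertex (several cops may share a vertex), then the second player places one robber on a vertex. The players then alternate turns, the first player first: on her turn each cop stays at its vertex or moves along a directed edge to an out-neighbor; on his turn the robber stays or moves along a directed edge to an out-neighbor. The game has perfect information. The first player wins if at some point a cop occupies the robber's vertex; otherwise the second player wins. The cop number $c(G)$ is the least number of cops for which the first player has a winning strategy. A directed path from $v$ to $u$ is geodesic if its length equals $\mathrm{dist}(v,u)$. Two paths are internally disjoint if neither contains an internal vertex of the other. Write $\Vert P\Vert$ for the length of a path $P$. A $(v,u)$-trap is a subdigraph of $G$ consisting of two internally disjoint geodesic paths $P$ and $Q$, where $P$ is a directed $(v,x)$-path with at least one edge, $Q$ is a directed $(u,x)$-path, and $\Vert Q\Vert \le \Vert P\Vert$. The vertex $x$ is the tip of the trap and $\Vert P\Vert$ is the length of the trap. It is allowed that $u=x$ (so $Q$ has length $0$). It is also allowed that $u=v$, but then $P$ and $Q$ are each required to have at least two edges. For an integer $m\ge 1$,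 $G$ is $m$-dispersed if: (1) for all $v,u \in V(G)$ with $v \ne u$, $G$ has no two internally disjoint $(v,u)$-traps (i.e. two distinct traps having no vertices in common other than $v$ and $u$), each of length at most $m$; (2) if $uv \in E(G)$, then $G$ has no $(v,u)$-trap of length at most $m$. Given positive integers $h,q$, a digraph $G$ has $(h,q)$-growth if for every vertex $v \in V(G)$ and every in-neighbor $y$ of $v$, the number of vertices $w$ satisfying $\mathrm{dist}(v,w)=h$ and $\mathrm{dist}(y,w)\ge h$ is at least $q$.
   Formalization: The digraph G is additionally assumed to have at least one edge; for edgeless digraphs both conditions hold vacuously for every q, so the bound fails (e.g. one vertex, h = t = 1, q = 100). *)

(* Defs.v *)
From HB Require Import structures.
From mathcomp Require Import all_boot all_order all_algebra.
From mathcomp Require Import boolp reals sequences.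

Set Implicit Arguments.
Unset Strict Implicit.
Unset Printing Implicit Defensive.

(* A finite digraph is an irreflexive relation E on a finite type T; E u v is
   the edge from u to v.  Irreflexivity excludes loops, a relation has no
   parallel edges, and E u v && E v u is a digon. *)

(* The vertices of the path are v :: p, so its length is size p. *)
Definition dpath (T : finType) (E : rel T) (v u : T) (p : seq T) : bool :=
  [&& path E v p, last v p == u & uniq (v :: p)].

(* None stands for infinity; a path has at most #|T| vertices, so its length is
   in iota 0 #|T|. *)
Definition dist (T : finType) (E : rel T) (v u : T) : option nat :=
  let lengths := [seq n <- iota 0 #|T| | [exists p : n.-tuple T, dpath E v u p]]
  in ohead lengths.

Definition dist_geq (d : option nat) (n : nat) : bool :=
  if d is Some k then n <= k else true.

Definition geodesic (T : finType) (E : rel T) (v u : T) (p : seq T) : bool :=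
  dpath E v u p && (dist E v u == Some (size p)).

Definition internal (T : finType) (v : T) (p : seq T) : seq T :=
  behead (belast v p).

Definition internally_disjoint (T : finType) (v : T) (p : seq T)
    (u : T) (q : seq T) : bool :=
  ~~ has (mem (u :: q)) (internal v p) && ~~ has (mem (v :: p)) (internal u q).

Record trap (T : finType) (E : rel T) (v u : T) := Trap {
  tip : T;
  trapP : seq T;
  trapQ : seq T;
  trapP_geodesic : geodesic E v tip trapP;
  trapQ_geodesic : geodesic E u tip trapQ;
  trap_disjoint : internally_disjoint v trapP u trapQ;
  trapP_gt0 : 0 < size trapP;
  trap_leq : size trapQ <= size trapP;
  trap_closed : u = v -> 1 < size trapP /\ 1 < size trapQ
}.

Definition trap_length (T : finType) (E : rel T) (v u : T)
  (S : trap E v u) : nat := size (trapP S).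

Definition trap_vertices (T : finType) (E : rel T) (v u : T)
    (S : trap E v u) : {set T} :=
  [set x in v :: trapP S] :|: [set x in u :: trapQ S].

Definition path_edges (T : finType) (v : T) (p : seq T) : {set T * T} :=
  [set xy in zip (belast v p) p].

Definition trap_edges (T : finType) (E : rel T) (v u : T)
    (S : trap E v u) : {set T * T} :=
  path_edges v (trapP S) :|: path_edges u (trapQ S).

(* A trap is the subdigraph P u Q, so traps are compared as subdigraphs. *)
Definition trap_distinct (T : finType) (E : rel T) (v u : T)
    (S S' : trap E v u) : Prop :=
  (trap_vertices S, trap_edges S) <> (trap_vertices S', trap_edges S').

Definition traps_disjoint (T : finType) (E : rel T) (v u : T)
    (S S' : trap E v u) : Prop :=
  trap_distinct S S' /\
  trap_vertices S :&: trap_vertices S' \subset [set v; u].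

Definition dispersed (T : finType) (E : rel T) (m : nat) : Prop :=
  (forall v u : T, v <> u ->
     ~ exists S S' : trap E v u,
         [/\ traps_disjoint S S', trap_length S <= m & trap_length S' <= m])
  /\
  (forall u v : T, E u v -> ~ exists S : trap E v u, trap_length S <= m).

Definition has_growth (T : finType) (E : rel T) (h q : nat) : Prop :=
  forall v y : T, E y v ->
    q <= #|[set w | (dist E v w == Some h) && dist_geq (dist E y w) h]|.

Definition game_step (T : finType) (E : rel T) (x y : T) : bool :=
  (x == y) || E x y.

(* A strategy maps the robber's positions so far to the cops' next positions.
   The cops' own earlier positions are determined by this history, so they need
   not be arguments.  strat [::] is the initial placement. *)
Definition cop_strategy (T : finType) (k : nat) :=
  seq T -> {ffun 'I_k -> T}.

(* r 0 is the robber's initial vertex and r i his vertex after his i-th move;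
   strat (mkseq r i) are the cops' positions after their i-th move, which comes
   just before the robber's i-th move.  Play is continued after a capture, which
   is harmless because staying put is always legal. *)
Definition winning_cop_strategy (T : finType) (E : rel T) (k : nat)
    (strat : cop_strategy T k) : Prop :=
  forall r : nat -> T, (forall i, game_step E (r i) (r i.+1)) ->
    let c i := strat (mkseq r i) in
    (forall i j, game_step E (c i j) (c i.+1 j)) /\
    (exists i j, c i j = r i \/ c i.+1 j = r i).

Definition cops_win (T : finType) (E : rel T) (k : nat) : Prop :=
  exists strat : cop_strategy T k, winning_cop_strategy E strat.

Lemma exists_cops_win (T : finType) (E : rel T) :
  exists k, `[< cops_win E k >].
Proof.
exists #|T|; apply/asboolP; exists (fun=> [ffun j => enum_val j]).
move=> r _ /=; split=> [i j|]; first by rewrite /game_step eqxx.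
by exists 0, (enum_rank (r 0)); left; rewrite ffunE enum_rankK.
Qed.

Definition cop_number (T : finType) (E : rel T) : nat :=
  ex_minn (exists_cops_win E).

(* Main.v *)
(* Idea.  Say that a cop at u guards the out-neighbour c of the robber's vertex p
   if, for some x, a geodesic from p to x starts with c and
   dist(u, x) <= dist(p, x).  Dispersedness implies that a cop elsewhere than at
   p guards at most one out-neighbour of p: witnesses x, x' for two of them,
   taken as close to p as possible, span two internally disjoint traps from the
   pair (p, w), where w is the farthest common vertex of the geodesics from u to
   x and x'.

   The robber plays stages of h steps, each of which has at least q possible
   endpoints.  For j < t let n_j count the cops that reach some vertex within
   distance h (j + 1) - 1 of him no later than he does, and weight them by
   (q (1 - 1/t))^-j.  Averaging over the endpoints, a stage multiplies the
   potential sum_j n_j (q (1 - 1/t))^-j by at most 1 - 1/t and adds at most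
   k / (q (q (1 - 1/t))^(t-1)), which is less than 1/t if k <= q^t / (e t).
   So the potential can be kept below 1, whence n_0 = 0 after every stage, and
   this keeps the robber safe during the next stage. *)

Require Import Defs.
From mathcomp Require Import all_boot all_order all_algebra zify.
From mathcomp Require Import boolp reals sequences exp.

Set Implicit Arguments.
Unset Strict Implicit.
Unset Printing Implicit Defensive.

Import Order.TTheory GRing.Theory Num.Theory.

(** * Distances and geodesics *)

Section Distance.

Variables (T : finType) (E : rel T) (m : nat).

(* Distances with infinity encoded as a number exceeding both [m] and all finite
   distances, so that the triangle inequality holds unconditionally and
   [ndist v u <= m] implies that the distance is finite. *)
Definition ndist (v u : T) : nat := odflt (#|T| + m).+1 (dist E v u).

Lemma dist_dpath v u n : dist E v u = Some n ->
  n < #|T| /\ exists2 p, dpath E v u p & size p = n.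
Proof.
rewrite /dist; set s := filter _ _ => sn.
have : n \in s by case: s sn => //= a s [->]; rewrite inE eqxx.
rewrite mem_filter mem_iota /= => /andP[/existsP[p vup] ltn].
by split=> //; exists p => //; rewrite size_tuple.
Qed.

Lemma ndist_walk v p : path E v p -> ndist v (last v p) <= size p.
Proof.
case/shortenP=> p' vp' up' subp.
apply: (@leq_trans (size p')); last first.
  by apply: uniq_leq_size; [case/andP: up' | move=> z /subp].
have ltp : size p' < #|T|.
  by have := max_card (mem (v :: p')); rewrite (card_uniqP up').
rewrite /ndist /dist; set s := filter _ _.
have : size p' \in s.
  rewrite mem_filter mem_iota ltp /= andbT; apply/existsP.
  by exists (in_tuple p'); rewrite /dpath vp' eqxx.
have : sorted leq s by apply: sorted_filter (iota_sorted _ _); apply: leq_trans.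
case: s => //= a s ps; rewrite inE => /predU1P[->//|ins].
by have /allP/(_ _ ins) := order_path_min leq_trans ps.
Qed.

Lemma ndist_geodesic v u : ndist v u <= m ->
  exists2 p, geodesic E v u p & size p = ndist v u.
Proof.
rewrite /geodesic /ndist; case d: (dist E v u) => [n|] /=; last by lia.
by have [_ [p vup <-]] := dist_dpath d => _; exists p; rewrite ?vup /=.
Qed.

Lemma ndist_refl v : ndist v v = 0.
Proof. by have /= := @ndist_walk v [::] isT; lia. Qed.

Lemma ndist_eq0 v u : ndist v u = 0 -> v = u.
Proof.
by rewrite /ndist; case d: (dist E v u) => [[]|] //=;
  have [_ [[|//] /and3P[_ /eqP]]] := dist_dpath d.
Qed.

Lemma ndist_max v u : ndist v u <= (#|T| + m).+1.
Proof.
rewrite /ndist; case d: (dist E v u) => [n|] //=.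
by have [/ltnW ltn _] := dist_dpath d; rewrite leqW // (leq_trans ltn) ?leq_addr.
Qed.

Lemma ndist_triangle v u w : ndist v w <= ndist v u + ndist u w.
Proof.
have := ndist_max v w; rewrite [ndist v u]/ndist [ndist u w]/ndist.
case d: (dist E v u) => [n|] /=; last by lia.
case d': (dist E u w) => [n'|] /=; last by lia.
have [_ [p /and3P[vp /eqP lp _] <-]] := dist_dpath d.
have [_ [p' /and3P[vp' /eqP lp' _] <-]] := dist_dpath d' => _.
by rewrite -size_cat -lp' -lp -last_cat ndist_walk // cat_path vp lp.
Qed.

Lemma ndist_edge v u : E v u -> ndist v u <= 1.
Proof. by move=> Evu; apply: (@ndist_walk v [:: u]); rewrite /= Evu. Qed.

Lemma ndist_step v u : game_step E v u -> ndist v u <= 1.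
Proof. by case/predU1P=> [->|/ndist_edge //]; rewrite ndist_refl. Qed.

Lemma ndist_first v u r : ndist v u = r.+1 -> r < m ->
  exists2 c, E v c & ndist c u = r.
Proof.
move=> d ltr; have [|[|c p] /andP[/and3P[/= ]]] := @ndist_geodesic v u.
- by lia.
- by rewrite d.
move=> /andP[Evc cp] /eqP lp _ _; rewrite d => -[sp]; exists c => //.
have := ndist_walk cp; have := ndist_triangle v c u; have := ndist_edge Evc.
by rewrite lp sp d; lia.
Qed.

Definition between v u : pred T :=
  [pred z | ndist v z + ndist z u == ndist v u].

Lemma betweenE v u z : between v u z = (ndist v z + ndist z u == ndist v u).
Proof. by []. Qed.

Lemma geodesic_between v u p : ndist v u <= m -> geodesic E v u p ->
  {subset v :: p <= between v u}.
Proof.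
move=> dm /andP[/and3P[vp /eqP lp _] /eqP d] z zp.
have dE : ndist v u = size p by rewrite /ndist d.
have := ndist_triangle v z u; rewrite inE dE.
case/splitPl: zp vp lp {d dE} => p1 p2 lp1; rewrite cat_path last_cat lp1.
move=> /andP[/ndist_walk w1 /ndist_walk w2] lp2.
by rewrite lp1 in w1; rewrite lp2 in w2; rewrite size_cat; lia.
Qed.

End Distance.

(** * Traps, and the out-neighbours that a cop can guard *)

Section Dispersed.

Variables (T : finType) (E : rel T) (m : nat).
Hypotheses (E_irr : irreflexive E) (E_disp : dispersed E m).
Local Notation d := (ndist E m).

Lemma trap_of_geodesics v u x p q : v <> u ->
    geodesic E v x p -> geodesic E u x q -> size q <= size p ->
    (forall z, z \in v :: p -> z \in u :: q -> z = x) ->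
  exists2 S : trap E v u, trapP S = p & trapQ S = q.
Proof.
move=> vNu gp gq qp pqx.
have in_internal w s z : geodesic E w x s -> z \in internal w s ->
    z \in w :: s /\ z <> x.
  move=> /andP[/and3P[_ /eqP ls us] _] /mem_behead zs; split.
    by rewrite lastI mem_rcons inE zs orbT.
  by move=> zx; move: us; rewrite lastI rcons_uniq ls -zx zs.
have pq_disj : internally_disjoint v p u q.
  apply/andP; split; apply/hasPn => z /in_internal.
    by move=> /(_ gp)[zp zNx]; apply/negP => /= zq; exact/zNx/pqx.
  by move=> /(_ gq)[zq zNx]; apply/negP => /= zp; exact/zNx/pqx.
have p_gt0 : 0 < size p.
  case: p q gp gq qp {in_internal pqx pq_disj} => // -[|//] + + _.
  by move=> /andP[/and3P[_ /eqP/= vx _] _] /andP[/and3P[_ /eqP/= ux _] _];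
    case: vNu; rewrite vx ux.
have closed : u = v -> 1 < size p /\ 1 < size q by move/esym.
by exists (Trap gp gq pq_disj p_gt0 qp closed).
Qed.

(** Otherwise take [x] closest to [v] with [d y x <= d v x]. By minimality the geodesics from [v]
    and [y] to [x] meet only in [x], a trap that the edge from [y] to [v] forbids. *)
Lemma ndist_in_edge y v x : E y v -> d v x <= m -> d y x = (d v x).+1.
Proof.
move=> Eyv dm; have := ndist_triangle E m y v x; have := ndist_edge m Eyv.
suff: ~~ (d y x <= d v x) by lia.
apply/negP => dle.
pose Q z := (d y z <= d v z) && (d v z <= m).
have Qx : Q x by rewrite /Q dle.
case: (arg_minnP (d v) Qx) => {dle dm Qx} {}x /andP[dle dm] xmin.
have yNv : v <> y by move=> vy; rewrite vy E_irr in Eyv.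
have dm' : d y x <= m by lia.
have [p gp sp] := ndist_geodesic dm; have [q gq sq] := ndist_geodesic dm'.
case: (E_disp) => _ /(_ y v Eyv); apply.
have [||S pS qS] := trap_of_geodesics yNv gp gq; first by lia.
  move=> z /(geodesic_between dm gp) + /(geodesic_between dm' gq).
  rewrite !inE => zp zq; have := ndist_triangle E m y z x.
  have /xmin : Q z by rewrite /Q; lia.
  by move=> ??; apply: (@ndist_eq0 _ E m); lia.
by exists S; rewrite /trap_length pS; lia.
Qed.

Definition guards u p c x :=
  [&& d u x <= d p x, d p x == (d c x).+1 & d p x <= m].

(* The witnesses [x i] are as close to [p] as possible; this alone makes the
   geodesics from [u] meet those through the [c i] in their endpoints only. *)
Lemma no_two_guards u p (c x : bool -> T) : u <> p -> c false <> c true ->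
    (forall i, E p (c i)) -> (forall i, guards u p (c i) (x i)) ->
    (forall i z, guards u p (c i) z -> d p (x i) <= d p z) ->
    (forall z, ~ (between E m (c false) (x false) z /\
                  between E m (c true) (x true) z)) ->
  False.
Proof.
move=> uNp cN Epc gx xmin disj.
have dux i : d u (x i) <= m by case/and3P: (gx i); lia.
have dpx i : d p (x i) <= m by case/and3P: (gx i); lia.
have dcx i : d (c i) (x i) <= m by case/and3P: (gx i); lia.
have dpc i z : between E m (c i) (x i) z -> d p z = (d (c i) z).+1.
  rewrite betweenE; have := ndist_triangle E m p (c i) z.
  have := ndist_triangle E m p z (x i); have := ndist_edge m (Epc i).
  by case/and3P: (gx i); lia.
have meet i j z : between E m u (x i) z -> between E m (c j) (x j) z ->
    z = x j.
  move=> zu zc; have := dpc j z zc; move: zu zc; rewrite !betweenE => zu zc dpz.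
  have /xmin : guards u p (c j) z.
    have := ndist_triangle E m p z (x i).
    by case/and3P: (gx i) (gx j) => + + + /and3P[]; rewrite /guards; lia.
  move=> le; apply: (@ndist_eq0 _ E m).
  by case/and3P: (gx j); lia.
have pNu i : ~~ between E m u (x i) p.
  apply/negP; rewrite betweenE => up; apply/uNp/(@ndist_eq0 _ E m).
  by case/and3P: (gx i); lia.
pose Q z := between E m u (x false) z && between E m u (x true) z.
have Qu : Q u by rewrite /Q !betweenE !ndist_refl !add0n !eqxx.
case: (arg_maxnP (d u) Qu) => w Qw wmax {Qu}.
have Qw' i : between E m u (x i) w by case/andP: Qw => ??; case: i.
have pNw : p <> w by move=> pw; have := pNu true; rewrite pw Qw'.
have dwx i : d w (x i) <= m by have := Qw' i; have := dux i; rewrite betweenE; lia.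
have sub i z : between E m w (x i) z ->
    between E m u (x i) z /\ d u w + d w z <= d u z.
  have := Qw' i; have := ndist_triangle E m u w z.
  by have := ndist_triangle E m u z (x i); rewrite !betweenE; lia.
have max_w i z : between E m w (x i) z -> Q z -> z = w.
  move=> /sub[_ le] /wmax ge.
  by apply/esym/(@ndist_eq0 _ E m); lia.
have endp v i : between E m v (x i) (x i) by rewrite betweenE ndist_refl addn0.
(* Such a [z] is [x i] by [meet], so it lies on geodesics from [u] to both witnesses and is [w] by
   maximality. *)
have meet' i z : between E m (c i) (x i) z -> between E m w (x (~~ i)) z ->
    z = w.
  move=> zc zw; have zx := meet _ _ _ (sub _ _ zw).1 zc.
  apply: (max_w _ _ zw); rewrite /Q.
  have := (sub _ _ zw).1; rewrite {zc zw}zx => zu'.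
  by move: (endp u i) zu'; case: (i) => /= -> ->.
have mk i : exists2 S : trap E p w, trap_length S <= m &
    exists s q, [/\ trapP S = c i :: s, trapQ S = q,
      {subset c i :: s <= between E m (c i) (x i)} &
      {subset w :: q <= between E m w (x i)}].
  have [s gs ss] := ndist_geodesic (dcx i).
  have [q gq sq] := ndist_geodesic (dwx i).
  have subs := geodesic_between (dcx i) gs.
  have subq := geodesic_between (dwx i) gq.
  have gp : geodesic E p (x i) (c i :: s).
    case/andP: (gs) => /and3P[ps ls us] _; rewrite /geodesic /dpath /= Epc ps.
    move: ls us => /= -> /= ->; rewrite andbT; apply/andP; split.
      apply/negP => /subs/dpc; by rewrite ndist_refl.
    have [p' /andP[_ /eqP ->] ->] := ndist_geodesic (dpx i).
    by rewrite ss; case/and3P: (gx i) => _ /eqP ->.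
  have le : size q <= size (c i :: s).
    have := Qw' i; rewrite betweenE /= sq ss.
    by case/and3P: (gx i); lia.
  have [z|S pS qS] := trap_of_geodesics pNw gp gq le.
    rewrite inE => /predU1P[->|/subs zs] /subq zq.
      by have := pNu i; rewrite (sub _ _ zq).1.
    exact: meet (sub _ _ zq).1 zs.
  exists S; last by exists s, q.
  by rewrite /trap_length pS /= ss; case/and3P: (gx i); lia.
have [S lS [s [q [pS qS subs subq]]]] := mk false.
have [S' lS' [s' [q' [pS' qS' subs' subq']]]] := mk true.
have capS : trap_vertices S :&: trap_vertices S' \subset [set p; w].
  apply/subsetP => z; rewrite !inE pS qS pS' qS'.
  case: eqVneq => //= zNp; rewrite -!in_cons => zz.
  have {}zz : ((z \in c false :: s) || (z \in w :: q)) &&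
    ((z \in c true :: s') || (z \in w :: q')) by rewrite zz.
  case/andP: zz => /orP[/subs|/subq] zS /orP[/subs'|/subq'] zS'; apply/eqP.
  - by case: (disj z).
  - exact: meet' zS zS'.
  - exact: (meet' true) zS' zS.
  - by apply: (max_w _ _ zS); rewrite /Q (sub _ _ zS).1 (sub _ _ zS').1.
case: (E_disp) => /(_ p w pNw) + _; apply; exists S, S'; split=> //; split=> //.
(* Equal traps would have all vertices in [[set p; w]], so both [c i], which differ from [p], would
   be [w]. *)
rewrite /trap_distinct => -[eqV _].
have cw i : c i = w.
  have : c i \in trap_vertices S :&: trap_vertices S'.
    rewrite -eqV setIid /trap_vertices; case: i; last by rewrite pS !inE eqxx orbT.
    by rewrite -/(trap_vertices S) eqV /trap_vertices pS' !inE eqxx orbT.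
  move/(subsetP capS); rewrite !inE => /orP[/eqP cp|/eqP //].
  by have := Epc i; rewrite cp E_irr.
by apply: cN; rewrite !cw.
Qed.

(** A cop at [c] guards [c] with witness [c], and would guard [c'] with witness [z], so
    [no_two_guards] applies with [u = c]. *)
Lemma ndist_first_unique p c c' z : E p c -> E p c' ->
  d p z = (d c z).+1 -> d p z = (d c' z).+1 -> d p z <= m -> c = c'.
Proof.
move=> Epc Epc' dc dc' dm; case: (eqVneq c c') => // cNc'.
have pNc : c <> p by move=> cp; rewrite cp E_irr in Epc.
have dpc : d p c = 1.
  have := ndist_edge m Epc; case dpc: (d p c) => [|n]; last by lia.
  by case: pNc; rewrite (ndist_eq0 dpc).
have gz : guards c p c' z by rewrite /guards; lia.
case: (arg_minnP (d p) gz) => x gx xmin.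
case: (@no_two_guards c p (fun b => if b then c' else c)
  (fun b => if b then x else c)) => //.
- by apply/eqP.
- by case.
- by case=> //; rewrite /guards dpc ndist_refl; lia.
- by case=> [|y]; [exact: xmin | rewrite dpc; case/and3P; lia].
move=> y /=; rewrite !betweenE ndist_refl => -[/eqP dy] + .
have yc : c = y by apply: (@ndist_eq0 _ E m); lia.
rewrite -yc => /eqP dy'; case/and3P: gx => _ /eqP dx _.
have tri := ndist_triangle E m p c x; case/eqP: cNc'.
by apply/esym/(@ndist_eq0 _ E m); lia.
Qed.

(** By [ndist_first_unique] no vertex lies on geodesics to the witnesses through both [c] and [c'],
    the last hypothesis of [no_two_guards]. *)
Lemma guards_unique u p c c' x x' : u <> p -> E p c -> E p c' ->
  guards u p c x -> guards u p c' x' -> c = c'.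
Proof.
move=> uNp Epc Epc' gx gx'; case: (eqVneq c c') => // cNc'.
case: (arg_minnP (d p) gx) => {gx} {}x gx xmin.
case: (arg_minnP (d p) gx') => {gx'} {}x' gx' xmin'.
case: (@no_two_guards u p (fun b => if b then c' else c)
  (fun b => if b then x' else x)) => //; first exact/eqP.
- by case.
- by case.
- by case.
move=> z [/=]; rewrite !betweenE => zc zc'.
have := ndist_triangle E m p c z; have := ndist_triangle E m p z x.
have := ndist_triangle E m p c' z; have := ndist_triangle E m p z x'.
have := ndist_edge m Epc; have := ndist_edge m Epc'.
case/and3P: gx gx' => a1 a2 a3 /and3P[b1 b2 b3] ? ? ? ? ? ?.
case/eqP: cNc'; by apply: (@ndist_first_unique p _ _ z) => //; lia.
Qed.

End Dispersed.

(** * Double counting *)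

Lemma sum_card_disjoint (I J : finType) (P : pred I) (A : I -> {set J})
    (B : {set J}) :
    (forall i, P i -> A i \subset B) ->
    (forall i i' j, P i -> P i' -> j \in A i -> j \in A i' -> i = i') ->
  \sum_(i | P i) #|A i| <= #|B|.
Proof.
move=> sAB disj; under eq_bigr do rewrite -sum1_card.
rewrite (exchange_big_dep (mem B)) /= => [|i j Pi /(subsetP (sAB i Pi)) //].
rewrite -sum1_card; apply: leq_sum => j _.
case: (pickP (fun i => P i && (j \in A i))) => [i /andP[Pi ji]|none].
  rewrite (bigD1 i) ?Pi //= big1 // => i' /andP[/andP[Pi' ji'] /eqP].
  by rewrite (disj i i' j).
by rewrite big_pred0.
Qed.

Lemma card_le_sum_cover (I J : finType) (P : pred I) (A : I -> {set J})
    (B : {set J}) :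
    (forall j, j \in B -> exists2 i, P i & j \in A i) ->
  #|B| <= \sum_(i | P i) #|A i|.
Proof.
move=> cov; under eq_bigr do rewrite -sum1_card.
rewrite (exchange_big_dep xpredT) //= -sum1_card big_mkcond /=.
apply: leq_sum => j _; case: ifP => // /cov[i Pi ji].
by rewrite (bigD1 i) ?Pi.
Qed.

(** * The potential and the robber's strategy *)

Section Evasion.

Variables (T : finType) (E : rel T) (h t q k : nat).
Local Notation m := (h * (t + 1) - 1).
Hypotheses (h_gt0 : 0 < h) (t_gt0 : 0 < t).
Hypotheses (E_irr : irreflexive E) (E_disp : dispersed E m).
Hypothesis E_growth : has_growth E h q.
Hypothesis few_cops : t ^ t * k < q ^ t * t.-1 ^ t.-1.
Local Notation d := (ndist E m).
Implicit Types (p c : T) (U : {ffun 'I_k -> T}).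

(* The cops that reach some vertex within distance [l] of a robber at [p] no
   later than he does. *)
Definition threats l p U : {set 'I_k} :=
  [set i | [exists x, (d (U i) x <= d p x) && (d p x <= l)]].

(** The radius is [l.+1] because it is measured from [p], one step behind [c]. Cops at [p] are left
    out, as they may guard several out-neighbours. *)
Definition threats_via l p c U : {set 'I_k} :=
  [set i | (U i != p) &&
           [exists x, guards E m (U i) p c x && (d p x <= l.+1)]].

Definition sphere r p : {set T} := [set w | d p w == r].

Lemma sum_threats_via l p U :
  \sum_(c | E p c) #|threats_via l p c U| <= #|threats l.+1 p U|.
Proof.
apply: sum_card_disjoint => [c _|c c' i Epc Epc'].
  apply/subsetP => i; rewrite !inE => /andP[_ /existsP[x /andP[g le]]].
  by apply/existsP; exists x; rewrite le andbT; case/and3P: g.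
rewrite !inE => /andP[/eqP iNp /existsP[x /andP[g _]]].
move=> /andP[_ /existsP[x' /andP[g' _]]].
exact: (guards_unique E_irr E_disp iNp Epc Epc' g g').
Qed.

(** The robber gets exactly one closer to [x] by [ndist_in_edge], a cop at most one closer. The last
    hypothesis holds when no cop is at [p] and when the cops stand still. *)
Lemma threats_step l p c U U' : E p c -> l < m ->
    (forall i, game_step E (U i) (U' i)) ->
    (forall i, U i = p -> U' i = p) ->
  threats l c U' \subset threats_via l p c U.
Proof.
move=> Epc ltl mv stay; apply/subsetP => i.
rewrite !inE => /existsP[x /andP[le lel]].
have dpx : d p x = (d c x).+1.
  by apply: (ndist_in_edge E_irr E_disp) => //; lia.
have := ndist_triangle E m (U i) (U' i) x; have := ndist_step m (mv i).
case: eqVneq => [/stay Up|_] le1 tri /=.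
  by move: le; rewrite Up; lia.
by apply/existsP; exists x; rewrite /guards; lia.
Qed.

Lemma sphere_step r p : r < h ->
  #|sphere r.+1 p| <= \sum_(c | E p c) #|sphere r c|.
Proof.
move=> rh; apply: card_le_sum_cover => w; rewrite inE => /eqP dw.
have [|c Epc dc] := ndist_first dw; first by nia.
by exists c => //; rewrite inE dc.
Qed.

Lemma sphere_growth y p : E y p -> q <= #|sphere h p|.
Proof.
move=> Eyp; apply: leq_trans (E_growth Eyp) (subset_leq_card _).
by apply/subsetP => w; rewrite !inE /ndist => /andP[/eqP -> _] /=.
Qed.

(* [(q (1 - 1/t))^-j] scaled by [weight 0 = (q (t - 1))^(t - 1)] to be an
   integer; for [t = 1] the only weight is [0 ^ 0 = 1]. *)
Definition weight j := (q * t.-1) ^ (t.-1 - j) * t ^ j.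

(* The relevant distance when [r] steps of the current stage remain. *)
Definition horizon r j := h * j + r + h.-1.

Definition potential r p U :=
  \sum_(j < t) weight j * #|threats (horizon r j) p U|.

Definition potential_via r p c U :=
  \sum_(j < t) weight j * #|threats_via (horizon r j) p c U|.

Lemma potential_step r p c U U' : r < h -> E p c ->
    (forall i, game_step E (U i) (U' i)) ->
    (forall i, U i = p -> U' i = p) ->
  potential r c U' <= potential_via r p c U.
Proof.
move=> rh Epc mv stay; apply: leq_sum => j _.
rewrite leq_mul2l subset_leq_card ?orbT // threats_step //.
by have := ltn_ord j; rewrite /horizon; nia.
Qed.

(* Averaging over the out-neighbours [c] of [p], with weight [#|sphere r c|]. *)
Lemma walk_step F r p U : r < h ->
    potential r.+1 p U < #|sphere r.+1 p| * F ->
  exists2 c, E p c & potential_via r p c U < #|sphere r c| * F.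
Proof.
move=> rh lt; apply/exists_inP; apply: contraLR lt => none.
rewrite -leqNgt (leq_trans (leq_mul (sphere_step p rh) (leqnn F))) //.
rewrite big_distrl /=.
apply: (@leq_trans (\sum_(c | E p c) potential_via r p c U)).
  apply: leq_sum => c Epc; rewrite leqNgt; apply: contra none => lt.
  by apply/exists_inP; exists c.
rewrite /potential_via exchange_big /=; apply: leq_sum => j _.
rewrite -big_distrr leq_mul2l /=; apply/orP; right.
have -> : horizon r.+1 j = (horizon r j).+1 by rewrite /horizon; lia.
exact: sum_threats_via.
Qed.

(* A cop at horizon [j.+1] for the old stage is one at horizon [j] for the new
   stage; the cops entering at the last horizon number at most [k]. *)
Lemma potential_next_stage p U :
  t * potential h p U <= q * t.-1 * potential 0 p U + t ^ t * k.
Proof.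
rewrite /potential; have /prednK <- := t_gt0; rewrite big_ord_recr big_ord_recl.
rewrite /= !mulnDr; set a := (X in _ <= X + _ + _).
suff [H1 H2] :
    t.-1.+1 * (\sum_(i < t.-1) weight i * #|threats (horizon h i) p U|) <=
    q * t.-1 * (\sum_(i < t.-1) weight (bump 0 i) *
                                #|threats (horizon 0 (bump 0 i)) p U|) /\
    t.-1.+1 * (weight t.-1 * #|threats (horizon h t.-1) p U|) <=
    t.-1.+1 ^ t.-1.+1 * k.
  by rewrite leq_add // (leq_trans H1) ?leq_addl.
split.
  rewrite !big_distrr /=; apply: leq_sum => i _; rewrite /bump /=.
  have -> : horizon 0 (1 + i) = horizon h i by rewrite /horizon; nia.
  rewrite !mulnA leq_mul2r; apply/orP; right.
  rewrite /weight prednK // add1n expnS.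
  have -> : t.-1 - i = (t.-1 - i.+1).+1 by have := ltn_ord i; lia.
  by rewrite expnS; set x := _ ^ _; set y := _ ^ i; lia.
rewrite /weight subnn mul1n expnS prednK // mulnA leq_mul2l; apply/orP; right.
by apply: leq_trans (max_card _) _; rewrite card_ord.
Qed.

(** In [potential_next_stage] the old threats contribute at most [q * t.-1 * F] and the new ones
    less than [q * weight 0 <= q * F], together less than [t * (q * F)]. *)
Lemma stage_start F y p U : E y p -> weight 0 <= F -> potential 0 p U <= F ->
  potential h p U < #|sphere h p| * F.
Proof.
move=> /sphere_growth ge_q F0 FU; have := potential_next_stage p U.
have := few_cops; have -> : q ^ t * t.-1 ^ t.-1 = q * weight 0.
  by rewrite /weight muln1 subn0 expnMn mulnA -expnS prednK.
move=> few next; rewrite -(ltn_pmul2l t_gt0).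
apply: (@leq_trans (t * (q * F))); last by rewrite !leq_mul2l leq_mul2r ge_q !orbT.
apply: (leq_ltn_trans next).
apply: (@leq_trans (q * t.-1 * F + q * F)).
  by rewrite -addnS leq_add ?leq_mul // (leq_trans few) ?leq_mul.
by rewrite -mulnDl addnC -mulnS prednK // mulnA (mulnC q).
Qed.

(* The robber at [p] is to move, with [r.+1] steps left in the current stage. *)
Definition safe p U := exists r,
  [/\ r < h, threats r p U = set0, exists y, E y p &
      potential r.+1 p U < #|sphere r.+1 p| * weight 0].

Lemma safe_free p U i : safe p U -> U i <> p.
Proof.
case=> r [_ /setP/(_ i) + _ _] Up; rewrite !inE => /negbT/existsP; apply.
by exists p; rewrite Up ndist_refl.
Qed.

Lemma safe_stage_start y p U : E y p -> potential 0 p U < weight 0 -> safe p U.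
Proof.
move=> Eyp lt; exists h.-1; rewrite prednK //; split; last 1 first.
- by apply: stage_start Eyp _ _ => //; apply: ltnW.
- by [].
(* The term [j = 0] is [weight 0 * #|threats h.-1 p U|]; being below [weight 0], it vanishes. *)
- apply/eqP; rewrite -cards_eq0 -leqn0 -ltnS -(@ltn_pmul2l (weight 0)) ?muln1.
    apply: leq_ltn_trans lt; rewrite /potential -[in X in _ <= X](prednK t_gt0).
    by rewrite big_ord_recl /= /horizon muln0 !add0n leq_addr.
  by apply: leq_ltn_trans lt.
- by exists y.
Qed.

Lemma safe_step p U : safe p U -> exists2 c, E p c &
  forall U', (forall i, game_step E (U i) (U' i)) -> safe c U'.
Proof.
move=> sp; have Ufree i : U i <> p by exact: safe_free.
case: sp => r [rh thr _ /(walk_step rh)[c Epc lt]]; exists c => // U' mv.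
have stay i : U i = p -> U' i = p by move/Ufree.
have {}lt := leq_ltn_trans (potential_step rh Epc mv stay) lt.
case: r => [|r] in rh thr lt *.
  (* The stage ends: the sphere is a single point, so the potential is below [weight 0]. *)
  apply: (safe_stage_start Epc); move: lt; have -> : sphere 0 c = [set c].
    apply/setP => w; rewrite !inE; apply/eqP/eqP => [/ndist_eq0 //|->].
    by rewrite ndist_refl.
  by rewrite cards1 mul1n.
exists r; split=> //; [by lia | | by exists p].
apply/eqP; rewrite -subset0 -thr.
apply: subset_trans (threats_step Epc _ mv stay) _; first by nia.
apply/subsetP => i; rewrite !inE => /andP[_ /existsP[x /andP[g le]]].
by apply/existsP; exists x; rewrite le andbT; case/and3P: g.
Qed.

(* With the cops standing still, a full stage lowers the potential as long as it
   is at least [weight 0]; the robber's walk here is imaginary, so he may pass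
   through cops. *)
Lemma exists_safe y p U : E y p -> exists p', safe p' U.
Proof.
have walk F r y' p' : r <= h -> E y' p' ->
    potential r p' U < #|sphere r p'| * F ->
    exists y'' p'', E y'' p'' /\ potential 0 p'' U < F.
  elim: r y' p' => [|r IHr] y' p' rh Eyp lt.
    exists y', p'; split=> //; apply: leq_trans lt _.
    rewrite -[X in _ <= X]mul1n leq_mul2r; apply/orP; right.
    rewrite -(cards1 p') subset_leq_card //; apply/subsetP => w.
    by rewrite !inE => /eqP/ndist_eq0 ->.
  have [c Epc lt'] := walk_step rh lt; apply: (IHr p' c) => //; first exact: ltnW.
  apply: leq_ltn_trans lt'; apply: potential_step => // i.
  by rewrite /game_step eqxx.
have [n] := ubnP (potential 0 p U); elim: n y p => // n IHn y p ltn Eyp.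
case: (ltnP (potential 0 p U) (weight 0)) => [lt|ge].
  by exists p; exact: safe_stage_start Eyp lt.
have [y' [p' [Eyp' lt]]] := walk _ _ _ _ (leqnn h) Eyp
  (stage_start Eyp ge (leqnn _)).
by apply: IHn Eyp'; apply: leq_trans lt _.
Qed.

Lemma cops_lose y p : E y p -> ~ cops_win E k.
Proof.
move=> Eyp [strat win]; have [p0 safe0] := exists_safe (strat [::]) Eyp.
(* Staying put is the default, so that the robber's play is legal before it is known to be safe. *)
have /choice[f fP] : forall pU : T * {ffun 'I_k -> T}, exists c,
    game_step E pU.1 c /\ (safe pU.1 pU.2 -> forall U',
    (forall i, game_step E (pU.2 i) (U' i)) -> safe c U').
  case=> v U /=; have [/safe_step[c Evc cP]|nsafe] := EM (safe v U).
    by exists c; rewrite /game_step Evc orbT.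
  by exists v; rewrite /game_step eqxx.
(* The robber's placement [r 0] is treated as a move from the imaginary position [p0]. *)
pose hist := fix hist n := if n is n'.+1 then
  rcons (hist n') (f (last p0 (hist n'), strat (hist n'))) else [::].
pose r n := last p0 (hist n.+1).
have histE n : mkseq r n = hist n.
  elim: n => // n IHn; rewrite mkseqS IHn /=; congr rcons.
  by rewrite /r /= last_rcons.
have rE n : r n = f (last p0 (hist n), strat (hist n)) by rewrite /r /= last_rcons.
have [i|mv [i [j]]] := win r.
  by rewrite (rE i.+1); case: (fP (last p0 (hist i.+1), strat (hist i.+1))).
have {}mv n j' : game_step E (strat (hist n) j') (strat (hist n.+1) j').
  by have := mv n j'; rewrite !histE.
have safeP n : safe (last p0 (hist n)) (strat (hist n)).
  elim: n => [//|n IHn]; rewrite -/(r n) rE.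
  have [_ /(_ IHn)] := fP (last p0 (hist n), strat (hist n)); apply=> j'.
  exact: mv.
rewrite !histE => -[eq|]; last by rewrite /r; apply: safe_free.
(* The robber does not step onto a cop, since his move is safe even if the cops then stand still. *)
have [_] := fP (last p0 (hist i), strat (hist i)).
move=> /(_ (safeP i) (strat (hist i)))/=; rewrite -rE => safe_r.
by apply: (@safe_free (r i) (strat (hist i)) j) eq; apply: safe_r => j';
  rewrite /game_step eqxx.
Qed.

End Evasion.

(** * The numerical bound and the conclusion *)

Local Open Scope ring_scope.

(** For [t > 1] this is [(1 + 1/n)^n < e] with [n = t - 1], the [n]-th power of
    [1 + 1/n < exp (1/n)]. *)
Lemma expn_ratio_lt_expR (R : realType) (t : nat) : (0 < t)%N ->
  (t ^ t.-1)%:R < expR 1 * (t.-1 ^ t.-1)%:R :> R.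
Proof.
case: t => [//|[_|n _]] /=; first by rewrite mulr1 expR_gt1.
rewrite !natrX -ltr_pdivrMr ?exprn_gt0 ?ltr0n //.
have -> : expR 1 = expR n.+1%:R^-1 ^+ n.+1 :> R.
  by rewrite -expRM_natl mulfV // pnatr_eq0.
rewrite -expr_div_n ltrXn2r ?nnegrE ?expR_ge0 ?divr_ge0 ?ler0n //.
have -> : n.+2%:R / n.+1%:R = 1 + n.+1%:R^-1 :> R.
  by rewrite -natr1 mulrDl mulfV ?pnatr_eq0 // mul1r.
by rewrite expR_gt1Dx // invr_eq0 pnatr_eq0.
Qed.

Lemma few_cops_nat (R : realType) (t q k : nat) : (0 < t)%N -> (0 < q)%N ->
  k%:R <= 1 / (expR 1 * t%:R) * q%:R ^+ t :> R ->
  (t ^ t * k < q ^ t * t.-1 ^ t.-1)%N.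
Proof.
move=> t_gt0 q_gt0; rewrite mulrAC mul1r ler_pdivlMr; last first.
  by rewrite mulr_gt0 ?expR_gt0 ?ltr0n.
move=> le; rewrite -(ltr_nat R) -(ltr_pM2l (expR_gt0 1)).
apply: (@le_lt_trans _ _ ((t ^ t.-1)%:R * (q ^ t)%:R)).
  have -> : (t ^ t * k = t ^ t.-1 * (t * k))%N.
    by rewrite mulnA -expnSr prednK.
  rewrite natrM mulrCA ler_wpM2l // natrX (le_trans _ le) //.
  by rewrite natrM mulrA mulrC.
rewrite natrM mulrCA mulrC ltr_pM2l ?ltr0n ?expn_gt0 ?q_gt0 //.
exact: expn_ratio_lt_expR.
Qed.

Theorem theorem3p6 (R : realType) (h t q : nat) (T : finType) (E : rel T)
  (h_ge1 : (1 <= h)%N) (t_ge1 : (1 <= t)%N) (q_ge1 : (1 <= q)%N)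
  (E_irr : irreflexive E)
  (E_nonempty : exists u v : T, E u v)
  (E_dispersed : dispersed E (h * (t + 1) - 1)%N)
  (E_growth : has_growth E h q) :
  (cop_number E)%:R > 1 / (expR 1 * t%:R) * q%:R ^+ t :> R.
Proof.
rewrite ltNge; apply/negP => /(few_cops_nat t_ge1 q_ge1) few.
have [y [p Eyp]] := E_nonempty.
move: few; rewrite /cop_number; case: ex_minnP => k /asboolP win _ few.
exact: (cops_lose h_ge1 t_ge1 E_irr E_dispersed E_growth few Eyp).
Qed.
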